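(* The bicyclic monoid $B=\langle a,b\mid ab=1\rangle$ (monoid presentation) is not an LWF semigroup.
   Context: Maps are written on the right. A semigroup $S$ is LWF (locally wrapped by the class of finite semigroups) if for every finite subset $H$ of $S$ there exist a finite semigroup $D$ and a function $d:D\to S$ such that $H\subseteq Dd$ and for all $x',y'\in D$ with $x'd,\,y'd\in H$ one has $(x'y')d=(x'd)(y'd)$. *)

(* Defs.v *)
From HB Require Import structures.
From mathcomp Require Import all_boot generic_quotient.
From mathcomp Require Import boolp classical_sets functions cardinality.

Set Implicit Arguments.
Unset Strict Implicit.
Unset Printing Implicit Defensive.

Local Open Scope classical_set_scope.
Local Open Scope quotient_scope.
Local Open Scope group_scope.

Definition LWF (S : semigroupType) : Prop :=
  forall H : set S, finite_set H ->
  exists (D : semigroupType) (d : D -> S),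
    [/\ finite_set [set: D],
        H `<=` range d
      & forall x y : D, H (d x) -> H (d y) -> d (x * y) = d x * d y].

(* The congruence on the free monoid [seq X] generated by [rels]. *)
Inductive pres_cong (X : Type) (rels : seq X -> seq X -> Prop) :
    seq X -> seq X -> Prop :=
| pres_cong_rel u v : rels u v -> pres_cong rels u v
| pres_cong_refl u : pres_cong rels u u
| pres_cong_sym u v : pres_cong rels u v -> pres_cong rels v u
| pres_cong_trans u v w :
    pres_cong rels u v -> pres_cong rels v w -> pres_cong rels u w
| pres_cong_cat u v u' v' : pres_cong rels u v -> pres_cong rels u' v' ->
    pres_cong rels (u ++ u') (v ++ v').

Section PresentedMonoid.
Variables (X : choiceType) (rels : seq X -> seq X -> Prop).

Definition pres_congb (u v : seq X) : bool := `[< pres_cong rels u v >].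

Lemma pres_congb_refl : reflexive pres_congb.
Proof. by move=> u; apply/asboolP; exact: pres_cong_refl. Qed.

Lemma pres_congb_sym : symmetric pres_congb.
Proof.
by move=> u v; apply/idP/idP => /asboolP uv; apply/asboolP; exact: pres_cong_sym.
Qed.

Lemma pres_congb_trans : transitive pres_congb.
Proof.
move=> v u w /asboolP uv /asboolP vw; apply/asboolP.
exact: pres_cong_trans uv vw.
Qed.

Canonical pres_equiv :=
  EquivRel pres_congb pres_congb_refl pres_congb_sym pres_congb_trans.

(* The monoid with presentation < X | u = v for all u, v with rels u v >. *)
Definition presented_monoid := {eq_quot pres_equiv}.

HB.instance Definition _ := Choice.on presented_monoid.
HB.instance Definition _ := EqQuotient.on presented_monoid.

Definition pres_pi (u : seq X) : presented_monoid := \pi_presented_monoid u.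

Lemma pres_piP (u v : seq X) : pres_pi u = pres_pi v <-> pres_cong rels u v.
Proof.
split=> [/eqmodP /= /asboolP //|uv].
by apply/eqmodP => /=; apply/asboolP.
Qed.

Definition pres_mul (x y : presented_monoid) : presented_monoid :=
  pres_pi (repr x ++ repr y).

Definition pres_one : presented_monoid := pres_pi [::].

Lemma pres_reprK (x : presented_monoid) : pres_pi (repr x) = x.
Proof. exact: reprK. Qed.

Lemma pres_pi_cat (u v : seq X) :
  pres_mul (pres_pi u) (pres_pi v) = pres_pi (u ++ v).
Proof.
by apply/pres_piP; apply: pres_cong_cat; apply/pres_piP; rewrite pres_reprK.
Qed.

Lemma pres_mulA : associative pres_mul.
Proof.
move=> x y z; rewrite -(pres_reprK x) -(pres_reprK y) -(pres_reprK z).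
by rewrite !pres_pi_cat catA.
Qed.

Lemma pres_mul1 : left_id pres_one pres_mul.
Proof. by move=> x; rewrite -(pres_reprK x) pres_pi_cat. Qed.

Lemma pres_mulr1 : right_id pres_one pres_mul.
Proof. by move=> x; rewrite -(pres_reprK x) pres_pi_cat cats0. Qed.

HB.instance Definition _ := isSemigroup.Build presented_monoid pres_mulA.
HB.instance Definition _ :=
  Semigroup_isMonoid.Build presented_monoid pres_mul1 pres_mulr1.

End PresentedMonoid.

(* The two generators a and b are encoded as true and false. *)
Definition bicyclic_rels (u v : seq bool) : Prop :=
  u = [:: true; false] /\ v = [::].

Definition bicyclic : monoidType := presented_monoid bicyclic_rels.

Definition bicyclic_a : bicyclic := pres_pi bicyclic_rels [:: true].
Definition bicyclic_b : bicyclic := pres_pi bicyclic_rels [:: false].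

Lemma bicyclic_abE : bicyclic_a * bicyclic_b = 1.
Proof.
by rewrite /bicyclic_a /bicyclic_b [LHS]pres_pi_cat; apply/pres_piP/pres_cong_rel.
Qed.

(* Main.v *)
Require Import Defs.
From mathcomp Require Import monoid.
From mathcomp Require Import classical_sets cardinality.
From mathcomp Require Import all_boot.

(** Every LWF monoid [S] is Dedekind-finite: [a * b = 1] forces [b * a = 1]
    ([LWF_dedekind_finite]).  The bicyclic monoid violates this, because it acts
    on the natural numbers from the right with [a] as successor and [b] as
    truncated predecessor, and [b * a] then moves [0] to [1]
    ([bicyclic_ba_neq1]).

    To see Dedekind-finiteness, wrap [H := {1, a, b, b * a}] by a finite
    semigroup [D] and a map [d].  The map [d] respects the product of any two
    elements lying over [H], so longer products can be evaluated one factor at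
    a time while the values stay in [H].  The fibre of [1] is therefore a
    subsemigroup; choose in it an element [t] whose right
    ideal [t D] is as small as possible.  If [x] and [y] lie over [a] and [b],
    then [p := t x] and [q := t y] also lie over [a] and [b], and both map
    [t D] into itself by left multiplication.  Since [p q t] lies over [1],
    minimality says that [p q (t D)] is no smaller than [t D], so [p] and [q]
    both permute the finite set [t D].  Hence [v := q p], which lies over
    the idempotent [b * a], acts injectively on [t D].  It sends the part of
    [t D] over [b * a] into itself, and also sends [t t], which lies over [1],
    into that part.  A finite set has no room for one more point under an
    injection, so [1 = b * a]. *)

Set Implicit Arguments.
Unset Strict Implicit.
Unset Printing Implicit Defensive.

Local Open Scope group_scope.

(** Finiteness turns the injectivity of a composite into that of both factors,
    since the inner factor is then onto. *)
Lemma inj_in_comp_stable (T : finType) (f g : T -> T) (A : {set T}) :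
    g @: A \subset A -> #|A| <= #|f @: (g @: A)| ->
  {in A &, injective f} /\ {in A &, injective g}.
Proof.
move=> gA le_A_fgA.
have le_A_gA : #|A| <= #|g @: A| := leq_trans le_A_fgA (leq_imset_card _ _).
have gAE : g @: A = A by apply/eqP; rewrite eqEcard gA.
by split; apply/imset_injP; rewrite eqn_leq leq_imset_card //= -{2}gAE.
Qed.

(** The counting argument.  The operation on [D] is a plain function, so that
    the lemma applies to a finite type enumerating a given finite semigroup. *)
Lemma finite_wrapping_dedekind (S : monoidType) (a b : S) (D : finType)
    (mul : D -> D -> D) (d : D -> S) (x y : D) :
    a * b = 1 -> associative mul -> d x = a -> d y = b ->
    {in [pred z | d z \in [:: 1; a; b; b * a]] &,
      {morph d : u v / mul u v >-> u * v}} ->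
  b * a = 1.
Proof.
move=> ab1 mulA dx dy dM.
pose H := [:: 1; a; b; b * a].
have [H1 Ha Hb Hba] : [/\ 1 \in H, a \in H, b \in H & b * a \in H].
  by rewrite !inE !eqxx !orbT.
have dmul u v g h :
    d u = g -> d v = h -> g \in H -> h \in H -> d (mul u v) = g * h.
  by move=> du dv gH hH; rewrite dM ?du ?dv // inE ?du ?dv.
have dxy : d (mul x y) == 1 by rewrite (dmul _ _ a b) ?ab1.
case: (@arg_minnP _ (mul x y) [pred z | d z == 1]
  (fun z => #|[set mul z w | w : D]|) dxy) => t /eqP dt min_t.
set tD := [set mul t w | w : D] in min_t.
have in_tD z : mul t z \in tD by apply: imset_f.
have stable z : mul (mul t z) @: tD \subset tD.
  by apply/subsetP => _ /imsetP[w _ ->]; rewrite -mulA.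
pose p := mul t x; pose q := mul t y.
have dp : d p = a by rewrite (dmul _ _ 1 a) ?mul1g.
have dq : d q = b by rewrite (dmul _ _ 1 b) ?mul1g.
have dqt : d (mul q t) = b by rewrite (dmul _ _ b 1) ?mulg1.
have dpqt : d (mul p (mul q t)) = 1 by rewrite (dmul _ _ a b).
have min_pq : #|tD| <= #|mul p @: (mul q @: tD)|.
  rewrite -!imset_comp.
  have /min_t : mul p (mul q t) \in [pred z | d z == 1] by rewrite inE dpqt.
  by congr (_ <= #|pred_of_set _|); apply: eq_imset => w /=; rewrite !mulA.
have [p_inj q_inj] := inj_in_comp_stable (stable y) min_pq.
pose v := mul q p.
have v_inj : {in tD &, injective (mul v)}.
  move=> z w zD wD; rewrite -!(mulA q p) => /q_inj.
  have in_p u : u \in tD -> mul p u \in tD.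
    by move=> uD; apply: (subsetP (stable x)); apply: imset_f.
  by move=> /(_ (in_p z zD) (in_p w wD)) /p_inj; apply.
have dv : d v = b * a by exact: dmul.
have dtt : d (mul t t) = 1 by rewrite (dmul _ _ 1 1) ?mulg1.
pose A := [set w in tD | d w == b * a].
have AttD : mul t t |: A \subset tD.
  by rewrite subUset sub1set in_tD; apply/subsetP => w /setIdP[].
have v_tD w : mul v w \in tD by rewrite -!mulA.
have vA : mul v @: (mul t t |: A) \subset A.
  apply/subsetP => _ /imsetP[w wA ->]; rewrite inE v_tD /=.
  move: wA => /setU1P[->|/setIdP[_ /eqP dw]]; apply/eqP.
    by rewrite (dmul _ _ (b * a) 1) ?mulg1.
  (* [b * a] is idempotent because [a * b = 1] *)
  by rewrite (dmul _ _ (b * a) (b * a)) // mulgA -(mulgA b a b) ab1 mulg1.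
have [/setIdP[_]|ttNA] := boolP (mul t t \in A); first by rewrite dtt => /eqP.
have := subset_leq_card vA; rewrite card_in_imset; last first.
  by move=> z w /(subsetP AttD) zD /(subsetP AttD) wD; apply: v_inj.
by rewrite cardsU1 ttNA ltnn.
Qed.

Theorem LWF_dedekind_finite (S : monoidType) (a b : S) :
  LWF S -> a * b = 1 -> b * a = 1.
Proof.
move=> lwfS ab1; pose H := [:: 1; a; b; b * a].
have [D [d [/finite_seqP[s Ds] Hd dM]]] := lwfS [set` H]%classic (finite_seq H).
have Ps z : z \in s by have : [set: D]%classic z by []; rewrite Ds.
have [x _ dx] : range d a by apply: Hd; rewrite /= !inE eqxx orbT.
have [y _ dy] : range d b by apply: Hd; rewrite /= !inE eqxx !orbT.
pose inF z : seq_sub s := SeqSub (Ps z).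
apply: (@finite_wrapping_dedekind S a b (seq_sub s)
  (fun u v => inF (ssval u * ssval v)) (d \o @ssval _ s) (inF x) (inF y)) => //.
  by move=> u v w; apply: val_inj; rewrite /= mulgA.
by move=> u v uH vH; apply: dM.
Qed.

(** Successor followed by truncated predecessor is the identity, so this action
    of words is compatible with the relation [ab = 1]; in the other order the
    truncation at [0] shows. *)
Definition counter (n : nat) (w : seq bool) : nat :=
  foldl (fun k c => if c then k.+1 else k.-1) n w.

Lemma counter_cong (u v : seq bool) (n : nat) :
  pres_cong bicyclic_rels u v -> counter n u = counter n v.
Proof.
rewrite /counter => uv; elim: uv n => {u v}.
- by move=> _ _ [-> ->].
- by [].
- by move=> u v _ IH n; rewrite IH.
- by move=> u v w _ IHuv _ IHvw n; rewrite IHuv.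
- by move=> u v u' v' _ IH _ IH' n; rewrite !foldl_cat IH IH'.
Qed.

Lemma bicyclic_ba_neq1 : bicyclic_b * bicyclic_a <> 1.
Proof.
rewrite /bicyclic_a /bicyclic_b [LHS]pres_pi_cat.
by move/pres_piP/(counter_cong 0).
Qed.

Theorem proposition11 : ~ LWF bicyclic.
Proof.
by move/LWF_dedekind_finite/(_ bicyclic_abE); apply: bicyclic_ba_neq1.
Qed.
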